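(* Fix a prime power $q$ and an integer $k\geq 1$. Then $$\mu(G_q(n,k))\;\geq\;\left(\frac{k(q-1)}{(q^k-1)^2}+o(1)\right)q^n\qquad (n\to\infty).$$ Consequently $\mu(G_q(n,k))=\Theta_{q,k}(q^n)$ as $n\to\infty$. More precisely, for $n\ge 2k$, $$\mu(G_q(n,k))\;\leq\;\frac{q^n-1}{q-1}=\left(\frac1{q-1}+o(1)\right)q^n ,$$ where the $o(1)$ is as $n\to\infty$.
   Context: Metric dimension: for a finite connected simple graph $G$ with graph distance $d(\cdot,\cdot)$, a set $S\subseteq V(G)$ is resolving if the map $x\mapsto (d(s,x))_{s\in S}$ is injective on $V(G)$; $\mu(G)$ is the minimum size of a resolving set. Grassmann graph: for a prime power $q$ and $1\leq k\leq n/2$, the graph $G_q(n,k)$ has as vertices the $k$-dimensional subspaces of $\mathbb F_q^n$, two being adjacent when they meet in dimension $k-1$. The graph distance is $d(U,W)=k-\dim(U\cap W)$. Here $q,k$ are fixed, $o(1)$ denotes a quantity tending to $0$ as $n\to\infty$, and $\Theta_{q,k}(q^n)$ means bounded above and below by positive constants (depending only on $q,k$) times $q^n$ for all large $n$. The upper bound, for $k\ge2$, is a result of Bailey and Meagher from the earlier literature. *)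

(* Defs.v *)
From HB Require Import structures.
From mathcomp Require Import all_boot all_algebra.

Set Implicit Arguments.
Unset Strict Implicit.
Unset Printing Implicit Defensive.

Record sgraph := SGraph {
  vertex :> finType;
  adj : rel vertex;
  adj_sym : symmetric adj;
  adj_irrefl : irreflexive adj }.

Section MetricDimension.
Variable G : sgraph.
Implicit Types (x y : G) (S : {set G}).

Definition walk_len (m : nat) x y : bool :=
  [exists p : m.-tuple G, path (@adj G) x p && (last x p == y)].

(* The least length of a walk from x to y. A shortest walk has fewer than
   #|G| edges, so the search bound is harmless; the value is #|G| exactly when
   no walk exists, which does not occur in a connected graph. *)
Definition gdist x y : nat := find (fun m => walk_len m x y) (iota 0 #|G|).

(* [seq gdist s x | s in S] lists the values gdist s x in the fixed
   enumeration order of S, i.e. it is the vector (gdist s x)_(s in S). *)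
Definition resolving S : bool := injectiveb (fun x => [seq gdist s x | s in S]).

Definition metric_dim : nat :=
  #|[arg min_(S < [set: G] | resolving S) #|S| ]|.

Lemma gdistxx x : gdist x x = 0.
Proof.
have G0 : 0 < #|G| by apply/card_gt0P; exists x.
rewrite /gdist; case: #|G| G0 => [//|N] _ /=.
suff -> : walk_len 0 x x by [].
by apply/existsP; exists [tuple]; rewrite /= eqxx.
Qed.

Lemma gdist_eq0 x y : gdist x y = 0 -> x = y.
Proof.
have G0 : 0 < #|G| by apply/card_gt0P; exists x.
rewrite /gdist; case: #|G| G0 => [//|N] _ /=.
by case: ifP => // /existsP[p]; rewrite tuple0 /= => /eqP.
Qed.

Lemma resolvingP S :
  reflect (forall x y, (forall s, s \in S -> gdist s x = gdist s y) -> x = y)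
          (resolving S).
Proof.
apply: (iffP (injectiveP _)) => [inj x y xy|inj x y /eq_in_map xy].
  by apply: inj; apply/eq_in_map => s; rewrite mem_enum; apply: xy.
by apply: inj => s sS; apply: xy; rewrite mem_enum.
Qed.

Lemma resolving_setT : resolving [set: G].
Proof.
by apply/resolvingP => x y /(_ x (in_setT x)); rewrite gdistxx => /esym/gdist_eq0.
Qed.

Lemma metric_dimP :
  (exists2 S, resolving S & #|S| = metric_dim) /\
  (forall S, resolving S -> metric_dim <= #|S|).
Proof.
rewrite /metric_dim; case: arg_minnP => [|S rS minS]; first exact: resolving_setT.
by split=> //; exists S.
Qed.

End MetricDimension.

HB.instance Definition _ (F : finFieldType) (vT : vectType F) :=
  isCountable.Build {vspace vT}
    (pcan_pickleK (can_pcan (@VectorInternalTheory.vs2mxK F vT))).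
HB.instance Definition _ (F : finFieldType) (vT : vectType F) :=
  isFinite.Build {vspace vT}
    (pcan_enumP (can_pcan (@VectorInternalTheory.vs2mxK F vT))).

Section Grassmann.
Variables (F : finFieldType) (n k : nat).

Definition grass_vertex := {U : {vspace 'rV[F]_n} | \dim U == k}.

HB.instance Definition _ := Finite.on grass_vertex.

Definition grass_adj : rel grass_vertex :=
  fun U W => (\dim (val U :&: val W)).+1 == k.

Lemma grass_adj_sym : symmetric grass_adj.
Proof. by move=> U W; rewrite /grass_adj capvC. Qed.

Lemma grass_adj_irrefl : irreflexive grass_adj.
Proof.
by move=> U; rewrite /grass_adj capvv (eqP (valP U)); apply/negbTE; rewrite gtn_eqF.
Qed.

Definition grassmann : sgraph := SGraph grass_adj_sym grass_adj_irrefl.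

End Grassmann.

(* Main.v *)
Require Import Defs.
From mathcomp Require Import all_boot all_order all_algebra.
From mathcomp Require Import all_classical all_reals all_analysis.
From mathcomp Require Import finfield zify ring lra.
Import Order.TTheory GRing.Theory Num.Theory.
Import numFieldNormedType.Exports.

(** For the upper bound, let [1_U] be the indicator vector over the rationals of
    the set of lines contained in [U]. The number [<1_U, 1_W>] of common lines
    depends only on [dim (U :&: W)], hence only on the distance of [U] and [W].
    If the vectors [1_s], for [s] in [S], form a basis of the span of all the
    [1_U], then two vertices [x], [y] with the same distances to [S] satisfy
    [1_x - 1_y] orthogonal to every [1_U], hence to itself, so [x = y]. Such an
    [S] has at most as many elements as there are lines.

    For the lower bound, let [S] be resolving. Counting nonzero vectors, each
    [s] meets nontrivially a proportion at most
    [(q^k - 1)^2 / ((q - 1) (q^n - 1))] of the vertices. On the other hand a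
    vertex is determined by its distances smaller than [k], so at most
    [(k |S| + 1)^(k-1) = O(q^(n (k-1)))] vertices, out of at least
    [q^(k (n-k))], meet fewer than [k] elements of [S]. The average number of
    elements of [S] met by a vertex is therefore at least [k (1 - O(q^-n))]. *)

Set Implicit Arguments.
Unset Strict Implicit.
Unset Printing Implicit Defensive.

(** * Walks, and the distance in the Grassmann graph *)

Lemma walk_lenP (G : sgraph) m (x y : G) :
  reflect (exists p, [/\ path (@adj G) x p, last x p = y & size p = m])
          (walk_len m x y).
Proof.
apply: (iffP existsP) => [[p /andP[xp /eqP py]]|[p [xp py /eqP sp]]].
  by exists p; rewrite size_tuple.
by exists (Tuple sp); rewrite /= xp py eqxx.
Qed.

(** Shortening a walk to a duplicate-free one shows that the minimal length [d] is below [#|G|], so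
    the search in [gdist] reaches it. *)
Lemma gdist_eqP (G : sgraph) (x y : G) d :
  (exists p, [/\ path (@adj G) x p, last x p = y & size p = d]) ->
  (forall p, path (@adj G) x p -> last x p = y -> d <= size p) ->
  gdist x y = d.
Proof.
move=> wd mind.
have ltdG : d < #|G|.
  case: wd mind => p [xp py _]; move: py; case/shortenP: xp => p' xp' up' _ py mind.
  apply: leq_ltn_trans (mind _ xp' py) _.
  by rewrite -[(size p').+1]/(size (x :: p')) -(card_uniqP up') max_card.
rewrite /gdist; apply/eqP; rewrite eqn_leq; apply/andP; split.
  rewrite leqNgt; apply/negP => /(before_find 0).
  by rewrite nth_iota // add0n => /walk_lenP.
rewrite leqNgt; apply/negP => lt_d.
have hm : has (fun m => walk_len m x y) (iota 0 #|G|).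
  by rewrite has_find size_iota; apply: ltn_trans lt_d ltdG.
move: (nth_find 0 hm); rewrite nth_iota ?add0n; last first.
  by rewrite -[X in _ < X](size_iota 0) -has_find.
by case/walk_lenP => p [xp py sp]; move: (mind p xp py); rewrite sp leqNgt lt_d.
Qed.

Lemma capv_line_eq0 (K : fieldType) (vT : vectType K) (V : {vspace vT}) w :
  w \notin V -> (V :&: <[w]> = 0)%VS.
Proof.
move=> nwV; apply/eqP; rewrite -subv0; apply/subvP => x.
rewrite memv_cap => /andP[xV /vlineP[a xa]].
have [a0|a0] := eqVneq a 0%R; first by rewrite xa a0 GRing.scale0r mem0v.
case/negP: nwV; have -> : w = (a^-1 *: x)%R.
  by rewrite xa GRing.scalerA GRing.mulVf ?GRing.scale1r.
exact: memvZ.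
Qed.

Section Distance.
Variables (F : finFieldType) (n k : nat).
Implicit Types U W : grass_vertex F n k.

Lemma dim_val U : \dim (val U) = k. Proof. exact/eqP/(valP U). Qed.

(** Both [U' :&: W] and [U :&: U'] lie in [U'], of dimension [k]; the second has dimension [k - 1],
    and they meet inside [U :&: W]. *)
Lemma grass_adj_cap U U' W : grass_adj U U' ->
  \dim (val U' :&: val W) <= (\dim (val U :&: val W)).+1.
Proof.
move=> /eqP adjUU'.
have := dimv_sum_cap (val U' :&: val W) (val U :&: val U').
have : \dim ((val U' :&: val W) + (val U :&: val U')) <= k.
  by apply: leq_trans (eq_leq (dim_val U')); rewrite dimvS // subv_add capvSl capvSr.
have : \dim ((val U' :&: val W) :&: (val U :&: val U')) <= \dim (val U :&: val W).
  apply: dimvS; rewrite subv_cap.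
  rewrite (subv_trans (capvSr _ _) (capvSl _ _)) /=.
  exact: subv_trans (capvSl _ _) (capvSr _ _).
lia.
Qed.

Lemma grass_path_cap U p : path (@grass_adj F n k) U p ->
  k <= \dim (val U :&: val (last U p)) + size p.
Proof.
elim: p U => [|V p IHp] U /=; first by rewrite capvv dim_val addn0.
case/andP=> adjUV /IHp le_k; apply: leq_trans le_k _.
by rewrite -addSnnS leq_add2r grass_adj_cap.
Qed.

Lemma grass_step U W : U != W ->
  exists2 V, grass_adj U V & \dim (val U :&: val W) < \dim (val V :&: val W).
Proof.
move=> neqUW.
have nUW : ~~ (val U <= val W)%VS.
  apply/negP => sUW; case/eqP: neqUW; apply: val_inj; apply/eqP.
  by rewrite eqEdim sUW !dim_val leqnn.
have nWU : ~~ (val W <= val U)%VS.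
  apply/negP => sUW; case/eqP: neqUW; apply: val_inj; apply/eqP.
  by rewrite eq_sym eqEdim sUW !dim_val leqnn.
have [w wW nwU] := subvPn nWU.
(* [H] below is a hyperplane of [U] containing [U :&: W]; exchanging the rest of
   [U] for [w] moves one step towards [W]. *)
pose C := (val U :\: val W)%VS.
have dC := dimv_cap_compl (val U) (val W); rewrite dim_val -/C in dC.
have C_gt0 : 0 < \dim C.
  have := dimvS (capvSl (val U) (val W)); rewrite dim_val leq_eqVlt.
  case/orP => [/eqP e|]; last lia.
  case/negP: nUW; apply/capv_idPl/eqP.
  by rewrite eqEdim capvSl e dim_val leqnn.
have Cn0 : vpick C != 0%R by rewrite vpick0 -dimv_eq0 -lt0n.
pose D := (C :\: <[vpick C]>)%VS.
have dD : (\dim D).+1 = \dim C.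
  have := dimv_cap_compl C <[vpick C]>.
  suff -> : (C :&: <[vpick C]> = <[vpick C]>)%VS by rewrite dim_vline Cn0 add1n.
  by apply/capv_idPr; rewrite -memvE memv_pick.
pose H := (val U :&: val W + D)%VS.
have sDU : (D <= val U)%VS by rewrite (subv_trans (diffvSl _ _)) ?diffvSl.
have sHU : (H <= val U)%VS by rewrite subv_add capvSl.
have dH : (\dim H).+1 = k.
  rewrite /H dimv_disjoint_sum; first by rewrite -addnS dD.
  apply/eqP; rewrite -subv0 -(capv_diff (val U) (val W)) subv_cap.
  rewrite (subv_trans (capvSr _ _) (diffvSl _ _)) /=.
  exact: subv_trans (capvSl _ _) (capvSr _ _).
have nwH : w \notin H by apply: contra nwU; apply: (subvP sHU).
have w0 : w != 0%R by apply: contraNneq nwU => ->; rewrite mem0v.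
have dV : \dim (H + <[w]>) == k.
  by rewrite dimv_disjoint_sum ?capv_line_eq0 // dim_vline w0 addn1 dH.
exists (exist (fun V => \dim V == k) _ dV).
  rewrite /grass_adj /= eqn_leq; apply/andP; split; last first.
    by rewrite -{1}dH ltnS dimvS // subv_cap sHU addvSl.
  apply: leq_trans (eq_leq (dim_val U)); rewrite ltn_neqAle dimvS ?capvSl // andbT.
  apply: contraNneq nwU => e.
  have sU : (val U <= H + <[w]>)%VS.
    by apply/capv_idPl/eqP; rewrite eqEdim capvSl e leqnn.
  have -> : val U = (H + <[w]>)%VS.
    by apply/eqP; rewrite eqEdim sU dim_val (eqP dV) leqnn.
  by apply: (subvP (addvSr _ _)); rewrite memv_line.
have <- : \dim (val U :&: val W + <[w]>) = (\dim (val U :&: val W)).+1.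
  rewrite dimv_disjoint_sum ?capv_line_eq0 ?dim_vline ?w0 ?addn1 //.
  by rewrite memv_cap (negPf nwU).
apply: dimvS; rewrite subv_cap !subv_add capvSr addvSr -memvE wW !andbT.
by rewrite (subv_trans (addvSl _ D)) ?addvSl.
Qed.

Lemma grass_gdist U W :
  @gdist (grassmann F n k) U W = k - \dim (val U :&: val W).
Proof.
apply: gdist_eqP => [|p Up pW]; last first.
  by have := grass_path_cap Up; rewrite pW leq_subLR.
have [d] := ubnP (k - \dim (val U :&: val W)).
elim: d U => [//|d IHd] U led; have [->|neqUW] := eqVneq U W.
  by exists [::]; rewrite capvv dim_val subnn.
have [V aUV ltV] := grass_step neqUW.
(* The gain in dimension is at least one by the choice of [V] and at most one by [grass_adj_cap]. *)
have eqd : k - \dim (val U :&: val W) = (k - \dim (val V :&: val W)).+1.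
  have leVk := dimvS (capvSl (val V) (val W)); rewrite dim_val in leVk.
  have -> : \dim (val V :&: val W) = (\dim (val U :&: val W)).+1.
    by apply/eqP; rewrite eqn_leq grass_adj_cap.
  by rewrite subnSK // (leq_trans ltV).
have [|p [Vp pW sp]] := IHd V; first by rewrite eqd in led.
by exists (V :: p); split; rewrite /= ?Vp ?andbT ?sp.
Qed.
End Distance.

(** * Counting the lines of a subspace *)

Section Lines.
Variables (F : finFieldType) (n : nat).
Implicit Types V W : {vspace 'rV[F]_n}.

Lemma card_nonzero V : #|[set v in V | v != 0%R]| = #|F| ^ \dim V - 1.
Proof.
have <- : #|V| = #|F| ^ \dim V by rewrite card_vspace.
rewrite (cardD1 0%R V) mem0v add1n subn1 /=.
by apply: eq_card => v; rewrite !inE andbC.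
Qed.

Lemma line_subset (L : grass_vertex F n 1) v W : v != 0%R -> v \in val L ->
  (val L <= W)%VS = (v \in W).
Proof.
move=> v0 vL; suff -> : val L = <[v]>%VS by rewrite -memvE.
by apply/eqP; rewrite eq_sym eqEdim -memvE vL dim_val dim_vline v0.
Qed.

Lemma line_through v : v != 0%R -> {L : grass_vertex F n 1 | v \in val L}.
Proof.
move=> v0; have dL : \dim <[v]> == 1 by rewrite dim_vline v0.
by exists (exist (fun L => \dim L == 1) _ dL); apply: memv_line.
Qed.

(** Double counting of pairs of a nonzero vector of [V] and the line through it: a line has
    [#|F| - 1] nonzero vectors. *)
Lemma card_lines V :
  #|[set L : grass_vertex F n 1 | (val L <= V)%VS]| * (#|F| - 1)
  = #|F| ^ \dim V - 1.
Proof.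
rewrite -(card_nonzero V) -[RHS]sum1_card -sum_nat_const.
transitivity (\sum_(v in [set v in V | v != 0%R])
                \sum_(L : grass_vertex F n 1 | v \in val L) 1); last first.
  apply: eq_bigr => v; rewrite inE => /andP[vV v0].
  have [L vL] := line_through v0.
  rewrite (big_pred1 L) // => L'; apply/idP/eqP => [vL'|-> //].
  apply: val_inj; apply/eqP; rewrite eqEdim !dim_val leqnn andbT.
  by rewrite (line_subset _ v0).
rewrite (exchange_big_dep (fun L : grass_vertex F n 1 => (val L <= V)%VS)) /=; last first.
  by move=> v L; rewrite inE => /andP[vV v0] vL; rewrite (line_subset _ v0).
apply: eq_big => [L|L]; rewrite inE // => sLV.
rewrite sum1dep_card; transitivity #|[set v in val L | v != 0%R]|.
  by rewrite card_nonzero dim_val expn1.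
apply: eq_card => v; rewrite !inE; case: eqP => _; rewrite ?andbF ?andbT //=.
by apply/idP/andP => [vL|[]//]; split=> //; apply: (subvP sLV).
Qed.

End Lines.

(** * The upper bound, by linear algebra over the rationals *)

Section UpperBound.
Variables (F : finFieldType) (n k : nat).
Local Notation vertices := (grass_vertex F n k).
Local Open Scope ring_scope.

Definition incidence :
    'M[rat]_(#|{: grass_vertex F n k}|, #|{: grass_vertex F n 1}|) :=
  \matrix_(i, j) ((val (enum_val j) <= val (enum_val i))%VS)%:R.

Lemma incidence_gram i j : (incidence *m incidence^T) i j =
  #|[set L : grass_vertex F n 1 |
       (val L <= val (enum_val i) :&: val (enum_val j))%VS]|%:R.
Proof.
rewrite mxE -sum1_card natr_sum [RHS]big_mkcond /=.
rewrite [RHS](reindex (@enum_val _ {: grass_vertex F n 1})) /=; last first.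
  exact/onW_bij/enum_val_bij.
apply: eq_bigr => l _; rewrite !mxE inE subv_cap.
by do 2!case: (_ <= _)%VS; rewrite ?mulr0 ?mulr1.
Qed.

Lemma incidence_gram_dim i j j' :
  \dim (val (enum_val i : vertices) :&: val (enum_val j : vertices)) =
  \dim (val (enum_val i : vertices) :&: val (enum_val j' : vertices)) ->
  (incidence *m incidence^T) i j = (incidence *m incidence^T) i j'.
Proof.
move=> eq_dim; rewrite !incidence_gram; congr (_%:R).
have q1 : (0 < #|F| - 1)%N by rewrite subn_gt0 finRing_gt1.
by apply/eqP; rewrite -(eqn_pmul2r q1) !card_lines eq_dim.
Qed.

(** Each nonzero vector of a subspace spans a line of it, so the lines inside a subspace determine
    it. *)
Lemma incidence_inj i j : row i incidence = row j incidence -> i = j.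
Proof.
move=> eq_row; apply: enum_val_inj; apply: val_inj; apply/eqP.
rewrite eqEdim !dim_val leqnn andbT; apply/subvP => v vi.
have [->|v0] := eqVneq v 0; first exact: mem0v.
have [L vL] := line_through v0.
have := congr1 (fun r : 'rV_ _ => r 0 (enum_rank L)) eq_row.
rewrite !mxE enum_rankK !(line_subset _ v0 vL) vi.
by case: (v \in _) => // /eqP; rewrite oner_eq0.
Qed.

Lemma metric_dim_le_lines :
  (metric_dim (grassmann F n k) <= #|{: grass_vertex F n 1}|)%N.
Proof.
(* The selected rows form a basis of the row space, so they are at most as many as the columns,
   which are the lines. *)
pose f := maxrankfun incidence.
pose S : {set grassmann F n k} := [set enum_val (f a) | a in 'I__].
have resS : resolving S.
  apply/resolvingP => x y xyS.
  pose i := enum_rank (x : grass_vertex F n k).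
  pose j := enum_rank (y : grass_vertex F n k).
  suff : i = j by apply: enum_rank_inj.
  apply: incidence_inj; apply/eqP; rewrite -subr_eq0.
  set D := row i incidence - row j incidence.
  have BD : rowsub f incidence *m D^T = 0.
    apply/matrixP => a b; rewrite linearB /= mulmxBr !tr_row !mxE.
    have colE z : \sum_l rowsub f incidence a l * col z incidence^T l b =
                  (incidence *m incidence^T) (f a) z.
      by rewrite mxE; apply: eq_bigr => l _; rewrite !mxE.
    rewrite !colE (@incidence_gram_dim _ i j) ?subrr // !enum_rankK.
    have := xyS (enum_val (f a)) (imset_f _ isT); rewrite !grass_gdist => eq_sub.
    (* The distance is a truncated difference; the dimension is recovered from it because it is at
       most [k]. *)
    have le_k (w : grass_vertex F n k) :
        (\dim (val (enum_val (f a) : grass_vertex F n k) :&: val w) <= k)%N.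
      by apply: leq_trans (eq_leq (dim_val w)); rewrite dimvS ?capvSr.
    by rewrite -[LHS](subKn (le_k x)) eq_sub subKn.
  (* Every row is a combination of the selected ones, so [D] is orthogonal to all rows and, being a
     difference of two rows, to itself. *)
  have {}BD : incidence *m D^T = 0.
    have : (incidence <= rowsub f incidence)%MS by rewrite eq_maxrowsub.
    by case/submxP => P ->; rewrite -mulmxA BD mulmx0.
  have DD : D *m D^T = 0.
    by rewrite {1}/D !rowE -mulmxBl -mulmxA BD mulmx0.
  apply/eqP/rowP => l; apply/eqP.
  move/matrixP/(_ 0 0)/eqP: DD; rewrite !mxE psumr_eq0 => [/allP/(_ l)|l' _].
    by rewrite mem_index_enum !mxE => /(_ isT)/=; rewrite mulf_eq0 orbb.
  by rewrite !mxE -expr2 sqr_ge0.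
apply: leq_trans (proj2 (metric_dimP _) _ resS) _.
by rewrite (leq_trans (leq_imset_card _ _)) // card_ord rank_leq_col.
Qed.

End UpperBound.

(** * Counting vertices that meet elements of a resolving set *)

Lemma card_small_sets (T : finType) m :
  #|[set A : {set T} | #|A| <= m]| <= #|T|.+1 ^ m.
Proof.
pose g (f : {ffun 'I_m -> option T}) := [set x | Some x \in codom f].
have <- : #|{ffun 'I_m -> option T}| = #|T|.+1 ^ m.
  by rewrite card_ffun card_option card_ord.
apply: leq_trans (leq_imset_card g _); apply/subset_leq_card/fintype.subsetP => A.
rewrite inE => leAm; apply/imsetP.
exists [ffun i : 'I_m => nth None (map Some (enum A)) i] => //.
apply/setP => x; rewrite inE; apply/idP/codomP => [xA|[i]].
  have lt_xm : index x (enum A) < m.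
    by apply: leq_trans leAm; rewrite cardE index_mem mem_enum.
  exists (Ordinal lt_xm); rewrite ffunE /= (nth_map x) ?nth_index ?mem_enum //.
  by rewrite index_mem mem_enum.
rewrite ffunE; case: (ltnP i (size (enum A))) => [lt_i|le_i].
  by rewrite (nth_map x) // => -[->]; rewrite -mem_enum mem_nth.
by rewrite nth_default ?size_map.
Qed.

Section Counting.
Variables (F : finFieldType) (n k : nat).
Implicit Types (U W : grass_vertex F n k) (v w : 'rV[F]_n).
Local Notation vertices := (grass_vertex F n k).
Local Notation q := #|F|.
Local Notation N := #|{: grass_vertex F n k}|.

Lemma unitmx_transitive v w : v != 0%R -> w != 0%R ->
  exists2 h : 'M[F]_n, h \in @unitmx F n & (v *m h)%R = w.
Proof.
move=> v0 w0; have vf : row_free v by rewrite /row_free rank_rV v0.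
(* This square matrix sends [v] to [w] but need not be invertible; [complete_unitmx] gives an
   invertible one with the same value at [v]. *)
have vpw : (v *m (pinvmx v *m w))%R = w by rewrite mulmxA mulmxVp // mul1mx.
have [|h hU e] := @complete_unitmx _ _ _ v (pinvmx v *m w)%R.
  by rewrite vpw !rank_rV v0 w0.
by exists h; rewrite // -e.
Qed.

(** An invertible matrix sending [v] to [w] maps the vertices through [v] injectively to vertices
    through [w]. Exchanging [v] and [w] gives equality. *)
Lemma card_through_le v w : v != 0%R -> w != 0%R ->
  #|[set U : vertices | v \in val U]| <= #|[set U : vertices | w \in val U]|.
Proof.
move=> v0 w0; have [h hU vh] := unitmx_transitive v0 w0.
pose f := linfun (mulmxr h : 'rV[F]_n -> 'rV[F]_n).
have fE u : f u = (u *m h)%R by rewrite lfunE.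
have f0 : lker f == 0%VS.
  by apply/lker0P => x y; rewrite !fE => /(can_inj (mulmxK hU)).
have df U : \dim (f @: val U) == k.
  by rewrite limg_dim_eq ?dim_val // (eqP f0) capv0.
pose g U : grass_vertex F n k := exist (fun V => \dim V == k) _ (df U).
have g_inj : injective g.
  move=> U W /(congr1 val) /= eUW; apply: val_inj.
  apply/vspaceP => x; apply/idP/idP => xin.
    have := memv_img f xin; rewrite eUW => /memv_imgP[y yW].
    by move/(lker0P f0) ->.
  have := memv_img f xin; rewrite -eUW => /memv_imgP[y yW].
  by move/(lker0P f0) ->.
rewrite -(card_imset _ g_inj).
apply/subset_leq_card/fintype.subsetP => _ /imsetP[U + ->].
by rewrite !inE /= => vU; rewrite -vh -fE memv_img.
Qed.

(** Double counting of pairs of a vertex and a nonzero vector in it, all nonzero vectors lying in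
    equally many vertices. *)
Lemma card_through v : v != 0%R ->
  #|[set U : vertices | v \in val U]| * (q ^ n - 1) = N * (q ^ k - 1).
Proof.
move=> v0.
have <- : #|[set w : 'rV[F]_n in fullv | w != 0%R]| = q ^ n - 1.
  by rewrite (card_nonzero (fullv : {vspace 'rV[F]_n})) dimvf dim_matrix GRing.mul1r.
transitivity (\sum_(w in [set w : 'rV[F]_n in fullv | w != 0%R])
                \sum_(U : vertices | w \in val U) 1).
  rewrite mulnC -sum_nat_const; apply: eq_bigr => w; rewrite inE => /andP[_ w0].
  rewrite sum1dep_card; apply/eqP.
  by rewrite eqn_leq !card_through_le.
rewrite (exchange_big_dep predT) //= -sum_nat_const.
apply: eq_bigr => U _; rewrite sum1dep_card.
transitivity #|[set w in val U | w != 0%R]|; last by rewrite card_nonzero dim_val.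
by apply: eq_card => w; rewrite !inE memvf andbC.
Qed.

(** Each [U] meeting [W] nontrivially contains at least [q - 1] of the [q ^ k - 1] nonzero vectors
    of [W]; [card_through] counts the vertices through each of these. *)
Lemma card_meet W :
  #|[set U : vertices | (val U :&: val W != 0)%VS]| * ((q - 1) * (q ^ n - 1)) <=
  N * (q ^ k - 1) ^ 2.
Proof.
rewrite mulnA expnSr expn1 mulnA.
suff le_sum : #|[set U : vertices | (val U :&: val W != 0)%VS]| * (q - 1) <=
   \sum_(w in [set w in val W | w != 0%R]) #|[set U : vertices | w \in val U]|.
  apply: leq_trans (leq_mul le_sum (leqnn _)) _; rewrite big_distrl /=.
  rewrite (eq_bigr (fun=> N * (q ^ k - 1))) => [|w]; last first.
    by rewrite inE => /andP[_ w0]; apply: card_through.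
  by rewrite sum_nat_const card_nonzero dim_val mulnC.
under eq_bigr do rewrite -sum1dep_card.
rewrite (exchange_big_dep predT) //= -sum_nat_const big_mkcond /=.
apply: leq_sum => U _; rewrite inE; case: eqP => //= /eqP UW0.
rewrite sum1dep_card.
have -> : #|[set w | (w \in [set w in val W | w != 0%R]) && (w \in val U)]| =
    #|[set w in (val U :&: val W)%VS | w != 0%R]|.
  by apply: eq_card => w; rewrite !inE memv_cap andbC andbA.
rewrite card_nonzero leq_sub2r // -{1}(expn1 q) leq_pexp2l //.
  exact: ltnW (finRing_gt1 F).
by rewrite lt0n dimv_eq0.
Qed.

Lemma card_few_meets (S : {set grassmann F n k}) : 0 < k -> resolving S ->
  #|[set U : vertices |
       #|[set s in S | (val U :&: val (s : vertices) != 0)%VS]| < k]|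
  <= (#|S| * k).+1 ^ k.-1.
Proof.
move=> k_gt0 resS.
(* [P U] is the part of the distance vector of [U] with entries smaller than
   [k]; the missing entries are all equal to [k]. *)
pose T : finType := ({s : grass_vertex F n k | s \in S} * 'I_k)%type.
have cT : #|{: T}| = #|S| * k by rewrite card_prod card_sig card_ord.
pose d (s U : vertices) := k - \dim (val s :&: val U).
have d_le s U : d s U <= k by apply: leq_subr.
pose P U : {set T} := [set t : T | d (val t.1) U == t.2].
have PE s (sS : s \in S) U (i : 'I_k) : ((exist _ s sS, i) \in P U) = (d s U == i).
  by rewrite inE.
have P_inj : injective P.
  move=> U W ePUW; apply: (resolvingP _ resS U W) => s sS; rewrite !grass_gdist.
  have memP U1 W1 : P U1 = P W1 -> d s U1 < k -> d s W1 = d s U1.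
    move=> /setP eP ltk; have := eP (exist _ s sS, Ordinal ltk).
    by rewrite !PE eqxx => /esym/eqP.
  rewrite -/(d s U) -/(d s W).
  have [ltU|leU] := ltnP (d s U) k; first exact/esym/memP.
  have [ltW|leW] := ltnP (d s W) k; first exact: memP.
  by apply/eqP; rewrite eqn_leq !(leq_trans (d_le _ _)).
rewrite -cT -(card_imset _ P_inj); apply: leq_trans (card_small_sets _ _).
apply/subset_leq_card/fintype.subsetP => _ /imsetP[U + ->].
rewrite !inE => ltUk; rewrite -ltnS prednK //; apply: leq_trans ltUk; rewrite ltnS.
(* An entry below [k] comes from an element of [S] meeting [U] nontrivially, and that element
   determines the entry, so [P U] is no larger than the set of such elements. *)
rewrite -(@card_in_imset _ _ (fun t : T => val t.1)).
  apply/subset_leq_card/fintype.subsetP => _ /imsetP[[[s sS] i] + ->].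
  rewrite PE inE /d capvC [val _]/= sS => /eqP eqd.
  apply: contraTneq (ltn_ord i) => UV0.
  by rewrite -eqd UV0 dimv0 subn0 ltnn.
move=> [s i] [s' i']; rewrite !inE => /eqP eqd /eqP eqd' ess.
congr (_, _); apply: val_inj => //.
by apply: etrans (esym eqd) (etrans _ eqd'); rewrite ess.
Qed.

(** Double counting of pairs of a vertex and an element of [S] meeting it nontrivially. [B] counts
    the vertices in fewer than [k] pairs; the others contribute at least [k] each, and [card_meet]
    bounds the pairs at each element of [S]. *)
Lemma resolving_count (S : {set grassmann F n k}) : 0 < k -> resolving S ->
  exists2 B, B <= (#|S| * k).+1 ^ k.-1 &
    k * (N - B) * ((q - 1) * (q ^ n - 1)) <= #|S| * (N * (q ^ k - 1) ^ 2).
Proof.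
move=> k_gt0 resS.
pose meets U := [set s in S | (val U :&: val (s : grass_vertex F n k) != 0)%VS].
pose few := [set U : vertices | #|meets U| < k].
exists #|few|; first exact: card_few_meets.
have -> : N - #|few| = #|~: few| by rewrite -(cardsC few) addKn.
apply: leq_trans (_ : (\sum_U #|meets U|) * ((q - 1) * (q ^ n - 1)) <= _).
  rewrite leq_mul2r; apply/orP; right.
  rewrite mulnC -sum_nat_const big_mkcond /=.
  by apply: leq_sum => U _; rewrite !inE -leqNgt; case: ifP.
under eq_bigr do rewrite -sum1dep_card.
rewrite (exchange_big_dep (mem S)) /=; last by move=> U s _ /andP[].
rewrite big_distrl -[leqRHS]sum_nat_const /=; apply: leq_sum => s sS.
apply: leq_trans (card_meet s); rewrite leq_mul2r sum1dep_card.
apply/orP; right; apply/subset_leq_card/fintype.subsetP => U.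
by rewrite !inE sS.
Qed.
End Counting.

(** * Both bounds in natural numbers *)

Lemma card_grass_ge (F : finFieldType) k l :
  #|F| ^ (k * l) <= #|{: grass_vertex F (k + l) k}|.
Proof.
(* The image of [f A] is the row space of the block matrix with blocks [1] and [A]. Its first [k]
   coordinates are free and determine the others, so this space determines [A]. *)
pose f (A : 'M[F]_(k, l)) :=
  linfun (mulmxr (row_mx 1%:M%R A) : 'rV[F]_k -> 'rV[F]_(k + l)).
have fE A u : f A u = row_mx u (u *m A)%R.
  by rewrite lfunE /= mul_mx_row mulmx1.
have f0 A : lker (f A) == 0%VS.
  by apply/lker0P => x y; rewrite !fE => /eq_row_mx[].
have df A : \dim (f A @: fullv) == k.
  by rewrite limg_dim_eq ?dimvf ?dim_matrix ?GRing.mul1r // (eqP (f0 A)) capv0.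
pose g A : grass_vertex F (k + l) k := exist (fun V => \dim V == k) _ (df A).
rewrite -(card_mx F); apply: (@leq_card _ _ g) => A B /(congr1 val) /= eAB.
apply/row_matrixP => i; rewrite !rowE.
have := memv_img (f A) (memvf (delta_mx 0%R i)); rewrite eAB => /memv_imgP[u _].
by rewrite !fE => /eq_row_mx[-> ->].
Qed.

Lemma card_all_lines (F : finFieldType) n :
  #|{: grass_vertex F n 1}| * (#|F| - 1) = #|F| ^ n - 1.
Proof.
have := card_lines (fullv : {vspace 'rV[F]_n}).
rewrite dimvf dim_matrix GRing.mul1r => <-; congr (_ * _).
by apply: eq_card => L; rewrite !inE subvf.
Qed.

Lemma metric_dim_upper (F : finFieldType) n k :
  metric_dim (grassmann F n k) * (#|F| - 1) <= #|F| ^ n - 1.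
Proof. by rewrite -card_all_lines leq_mul2r metric_dim_le_lines orbT. Qed.

(** [N] is the number of vertices and [B] comes from [resolving_count] for a minimum resolving set.
    The middle bound says that [B / N] is of order at most [#|F| ^ n] inverted. *)
Lemma metric_dim_lower (F : finFieldType) n k : 0 < k -> k <= n ->
  exists N B, [/\ 0 < N, B * #|F| ^ n <= (k ^ k.-1 * #|F| ^ (k * k)) * N &
    k * (N - B) * ((#|F| - 1) * (#|F| ^ n - 1)) <=
    metric_dim (grassmann F n k) * (N * (#|F| ^ k - 1) ^ 2)].
Proof.
move=> k_gt0 le_kn; have q_gt1 := finRing_gt1 F.
have [[S resS cardS] _] := metric_dimP (grassmann F n k).
have [B leB count] := resolving_count k_gt0 resS.
rewrite cardS in leB count.
have leN : #|F| ^ (k * (n - k)) <= #|{: grass_vertex F n k}|.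
  by have := card_grass_ge F k (n - k); rewrite subnKC.
exists #|{: grass_vertex F n k}|, B; split=> //.
  by apply: leq_trans leN; rewrite expn_gt0 ltnW.
have qn_gt0 : 0 < #|F| ^ n by rewrite expn_gt0 ltnW.
(* The upper bound feeds the lower one: a minimum resolving set has fewer than [#|F| ^ n] elements,
   which controls [B]. *)
have le_dim : (metric_dim (grassmann F n k) * k).+1 <= k * #|F| ^ n.
  have lt_dim : metric_dim (grassmann F n k) < #|F| ^ n.
    rewrite -(prednK qn_gt0) ltnS -subn1; apply: leq_trans (metric_dim_upper F n k).
    by rewrite leq_pmulr // subn_gt0.
  apply: leq_trans (_ : k * (metric_dim (grassmann F n k)).+1 <= _).
    by rewrite mulnC mulnS addnC -addn1 leq_add2l.
  by rewrite leq_mul2l lt_dim orbT.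
have {leB}leB : B <= (k * #|F| ^ n) ^ k.-1.
  by apply: leq_trans leB _; case: (k.-1) => // j; rewrite leq_exp2r.
apply: leq_trans (_ : (k * #|F| ^ n) ^ k.-1 * #|F| ^ n <= _).
  by rewrite leq_mul2r leB orbT.
rewrite expnMn -mulnA -expnSr prednK // -mulnA leq_mul2l; apply/orP; right.
apply: leq_trans (_ : #|F| ^ (k * k) * #|F| ^ (k * (n - k)) <= _).
  by rewrite -expnD -mulnDr subnKC // -expnM mulnC.
by rewrite leq_mul2l leN orbT.
Qed.

(** * Passage to real numbers and asymptotics *)

Local Open Scope classical_set_scope.
Local Open Scope ring_scope.

Section Asymptotics.
Variables (R : realType) (q : nat).
Hypothesis q_gt1 : (1 < q)%N.

Let q1 : 1 < q%:R :> R. Proof. by rewrite ltr1n. Qed.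

Lemma cvg_inv_expn (a : R) : a * (q%:R ^+ n)^-1 @[n --> \oo] --> (0 : R).
Proof.
rewrite -(mulr0 a); apply: cvgMr.
have -> : (fun n : nat => (q%:R ^+ n)^-1 : R) = GRing.exp (q%:R^-1).
  by apply/funext => n; rewrite exprVn.
apply: cvg_expr; rewrite ger0_norm ?invr_ge0 ?ler0n //.
by rewrite invf_lt1 // (lt_trans ltr01).
Qed.

Definition lower_const k : R := k%:R * (q%:R - 1) / (q%:R ^+ k - 1) ^+ 2.

(* The factor [1 - q^-n] comes from [q^n - 1]; the other one bounds below the
   proportion of vertices meeting at least [k] elements of a resolving set. *)
Definition lower_error k n : R := lower_const k *
  ((1 - (q%:R ^+ n)^-1) * (1 - (k ^ k.-1 * q ^ (k * k))%:R * (q%:R ^+ n)^-1) - 1).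

Lemma lower_const_gt0 k : (0 < k)%N -> 0 < lower_const k.
Proof.
move=> k_gt0; apply: divr_gt0; first by rewrite mulr_gt0 ?ltr0n ?subr_gt0.
by rewrite exprn_gt0 // subr_gt0 exprn_egt1 // -lt0n.
Qed.

Lemma cvg_lower_error k : lower_error k n @[n --> \oo] --> (0 : R).
Proof.
rewrite -(mulr0 (lower_const k)); apply: cvgMr.
have cvg1 (a : R) : 1 - a * (q%:R ^+ n)^-1 @[n --> \oo] --> (1 : R).
  by rewrite -[X in _ --> X]subr0; apply: cvgB; [exact: cvg_cst|exact: cvg_inv_expn].
rewrite -(subrr (1 : R)); apply: cvgB; last exact: cvg_cst.
rewrite -[X in _ --> X](mulr1 (1 : R)); apply: cvgM; last exact: cvg1.
by have := cvg1 1; under eq_fun do rewrite mul1r.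
Qed.

Lemma lower_bound (F : finFieldType) n k : #|F| = q -> (0 < k)%N -> (k <= n)%N ->
  (lower_const k + lower_error k n) * q%:R ^+ n <= (metric_dim (grassmann F n k))%:R.
Proof.
move=> Fq k_gt0 le_kn.
have [N [B [N_gt0 leB count]]] := metric_dim_lower F k_gt0 le_kn.
rewrite {}Fq in leB count.
set D := (k ^ k.-1 * q ^ (k * k))%N in leB; set mu := metric_dim _ in count *.
have qn_ge1 : 1 <= q%:R ^+ n :> R by rewrite exprn_ege1 // ltW.
have qn_gt0 : 0 < q%:R ^+ n :> R by rewrite (lt_le_trans ltr01).
have qkB1_gt0 : 0 < q%:R ^+ k - 1 :> R by rewrite subr_gt0 exprn_egt1 // -lt0n.
have qk_gt0 : 0 < (q%:R ^+ k - 1) ^+ 2 :> R by rewrite exprn_gt0.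
have q_gt0 : (0 < q)%N by rewrite ltnW.
have {}leB : B%:R <= D%:R * (q%:R ^+ n)^-1 * N%:R :> R.
  rewrite -mulrA [_^-1 * _]mulrC mulrA ler_pdivlMr //.
  by rewrite -natrX -!natrM ler_nat.
have natB1 j : (q ^ j - 1)%:R = q%:R ^+ j - 1 :> R.
  by rewrite natrB ?natrX // expn_gt0 q_gt0.
have {}count : k%:R * (N%:R - B%:R) * ((q%:R - 1) * (q%:R ^+ n - 1)) <=
    mu%:R * (N%:R * (q%:R ^+ k - 1) ^+ 2) :> R.
  (* The truncated [N - B] is at least the real difference, also if [B] exceeds [N]. *)
  apply: le_trans (_ : (k * (N - B) * ((q - 1) * (q ^ n - 1)))%:R <= _).
    rewrite natrM [(k * _)%:R]natrM [((_ - _) * _)%:R]natrM (natB1 1) natB1.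
    rewrite ler_wpM2r //.
      by rewrite mulr_ge0 // subr_ge0 // ltW.
    rewrite ler_wpM2l // lerBlDr -natrD ler_nat; lia.
  apply: le_trans (_ : (mu * (N * (q ^ k - 1) ^ 2))%:R <= _).
    by rewrite ler_nat.
  by rewrite natrM [(N * _)%:R]natrM [((_ - 1) ^ 2)%:R]natrX natB1.
have N0 : 0 < N%:R :> R by rewrite ltr0n.
rewrite -(ler_pM2r (mulr_gt0 N0 qk_gt0)); apply: le_trans count.
(* The right side is the count with [B] replaced by its bound; [lower_error] is chosen to make this
   an identity. *)
have -> : (lower_const k + lower_error k n) * q%:R ^+ n *
      (N%:R * (q%:R ^+ k - 1) ^+ 2)
   = k%:R * (N%:R - D%:R * (q%:R ^+ n)^-1 * N%:R) * ((q%:R - 1) * (q%:R ^+ n - 1)).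
  rewrite /lower_error /lower_const -/D; field.
  by rewrite !gt_eqF.
by rewrite ler_wpM2r ?mulr_ge0 ?subr_ge0 ?(ltW q1) // ler_wpM2l // lerB.
Qed.

Lemma upper_bound (F : finFieldType) n k : #|F| = q ->
  (metric_dim (grassmann F n k))%:R <= (q%:R ^+ n - 1) / (q%:R - 1) :> R.
Proof.
move=> Fq; have q_gt0 : (0 < q)%N by rewrite ltnW.
rewrite ler_pdivlMr ?subr_gt0 //.
have := metric_dim_upper F n k; rewrite Fq -(ler_nat R) natrM !natrB ?natrX //.
by rewrite expn_gt0 q_gt0.
Qed.
End Asymptotics.

Theorem theorem3p1 (R : realType) (p m q k : nat)
    (p_prime : prime p) (m_gt0 : (0 < m)%N) (q_def : q = (p ^ m)%N)
    (k_gt0 : (0 < k)%N) :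
  [/\ exists e : nat -> R,
        (e n @[n --> \oo] --> (0 : R)) /\
        forall F : finFieldType, #|F| = q ->
        forall n : nat, (2 * k <= n)%N ->
          (k%:R * (q%:R - 1) / (q%:R ^+ k - 1) ^+ 2 + e n) * q%:R ^+ n
            <= (metric_dim (grassmann F n k))%:R,
      exists c C : R, exists N : nat,
        [/\ 0 < c, 0 < C &
        forall F : finFieldType, #|F| = q ->
        forall n : nat, (2 * k <= n)%N -> (N <= n)%N ->
          c * q%:R ^+ n <= (metric_dim (grassmann F n k))%:R
            <= C * q%:R ^+ n],
      forall F : finFieldType, #|F| = q ->
        forall n : nat, (2 * k <= n)%N ->
          (metric_dim (grassmann F n k))%:R
            <= (q%:R ^+ n - 1) / (q%:R - 1) :> R
    & exists e : nat -> R,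
        (e n @[n --> \oo] --> (0 : R)) /\
        forall n : nat, (2 * k <= n)%N ->
          (q%:R ^+ n - 1) / (q%:R - 1) = ((q%:R - 1)^-1 + e n) * q%:R ^+ n].
Proof.
have q_gt1 : (1 < q)%N.
  by rewrite q_def -(exp1n m) ltn_exp2r // prime_gt1.
have qB1_gt0 : 0 < q%:R - 1 :> R by rewrite subr_gt0 ltr1n.
have qn_gt0 n : 0 < q%:R ^+ n :> R by rewrite exprn_gt0 // ltr0n ltnW.
have le_kn n : (2 * k <= n)%N -> (k <= n)%N by lia.
have c_gt0 := lower_const_gt0 R q_gt1 k_gt0.
split.
- exists (lower_error R q k); split; first exact: cvg_lower_error.
  by move=> F Fq n /le_kn; apply: lower_bound.
(* Past [N] the error takes away less than half of the constant, so the other half serves as [c]. *)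
- have [N _ small] : \forall n \near \oo,
      `|lower_error R q k n| < lower_const R q k / 2.
    by apply: (cvgr0_norm_lt _ (@cvg_lower_error R _ q_gt1 k)); rewrite divr_gt0.
  exists (lower_const R q k / 2), (q%:R - 1)^-1, N.
  split; [by rewrite divr_gt0|by rewrite invr_gt0|].
  move=> F Fq n le_n leNn; apply/andP; split.
    apply: le_trans (lower_bound R q_gt1 Fq k_gt0 (le_kn _ le_n)).
    rewrite ler_wpM2r ?ltW //; have := small n leNn; rewrite ltr_norml => /andP[]; lra.
  apply: le_trans (upper_bound R q_gt1 n k Fq) _.
  by rewrite [leRHS]mulrC ler_wpM2r ?invr_ge0 ?(ltW qB1_gt0) // gerBl.
- by move=> F Fq n _; apply: upper_bound.
(* This is the term [- 1 / (q - 1)] of the quotient, divided by [q ^ n]. *)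
exists (fun n => - (q%:R - 1)^-1 * (q%:R ^+ n)^-1); split; first exact: cvg_inv_expn.
by move=> n _; field; rewrite !gt_eqF.
Qed.
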